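(* Let $G$ be a group having an automorphism $\theta$ with the following property: there exist an element $b\in G$ and a natural number $n>2$ such that $\theta(b)=b$ and $\theta^{n-1}(x)=bxb^{-1}$ for all $x\in G$. Then $G$ is equational noetherian in the language $\mathcal{L}$ if and only if it is equational noetherian in the language $\mathcal{L}_{\theta}$.
   Context: $\mathcal{L}$ is the language of groups with coefficients in $G$: one binary symbol for the product, one unary symbol for the inverse, and all elements of $G$ as constants. $\mathcal{L}_{\theta}$ is the language obtained from $\mathcal{L}$ by adding $\theta$ as a second unary function symbol (interpreted in $G$ as the automorphism $\theta$). For one of these languages, an equation in variables $x_1,\ldots,x_m$ is an expression $p\approx q$ with $p,q$ terms of the language in these variables. A system is an arbitrary set $S$ of equations in a finite set of variables $x_1,\ldots,x_m$; its solution set is $V_G(S)=\{g\in G^m: p(g)=q(g)\text{ for all }(p\approx q)\in S\}$. $G$ is equational noetherian in the language if for every such system $S$ there is a finite subsystem $S_0\subseteq S$ with $V_G(S)=V_G(S_0)$. *)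

(* Defs.v *)
From mathcomp Require Import all_boot.
From mathcomp Require Import boolp classical_sets functions cardinality.

Set Implicit Arguments.
Unset Strict Implicit.
Unset Printing Implicit Defensive.

Local Open Scope classical_set_scope.
Local Open Scope group_scope.

(* Terms in the variables x_0, ..., x_(m-1) over the language of groups with
   coefficients in G, enriched with one further unary function symbol for
   each element of U. *)
Inductive term (G U : Type) (m : nat) : Type :=
| Var of 'I_m
| Const of G
| Mul of term G U m & term G U m
| Inv of term G U m
| App of U & term G U m.

Section EquationalNoetherian.
Variables (G : groupType) (U : Type).
(* interpretation in G of the additional unary symbols *)
Variable interp : U -> G -> G.

Fixpoint eval m (g : m.-tuple G) (t : term G U m) : G :=
  match t with
  | Var i => tnth g i
  | Const c => c
  | Mul p q => eval g p * eval g q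
  | Inv p => (eval g p)^-1
  | App u p => interp u (eval g p)
  end.

(* The pair (p, q) is the equation p ≈ q. *)
Definition equation (m : nat) : Type := (term G U m * term G U m)%type.

Definition solutions m (S : set (equation m)) : set (m.-tuple G) :=
  [set g | forall p q, S (p, q) -> eval g p = eval g q].

Definition equational_noetherian : Prop :=
  forall (m : nat) (S : set (equation m)),
    exists S0 : set (equation m),
      [/\ S0 `<=` S, finite_set S0 & solutions S = solutions S0].

End EquationalNoetherian.

(* The language L has no additional symbol. *)
Definition equational_noetherian_L (G : groupType) : Prop :=
  equational_noetherian (of_void (G -> G)).

(* The language L_theta has exactly one, interpreted as theta. *)
Definition equational_noetherian_Ltheta (G : groupType) (theta : G -> G) :
    Prop :=
  equational_noetherian (fun _ : unit => theta).

(* Main.v *)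
From mathcomp Require Import all_boot.
From mathcomp Require Import boolp classical_sets functions cardinality.
Require Import Defs.

(** A theta-term is turned into a plain group term by giving every variable
    [x] a separate name for each of [x, theta x, .., theta^(n-2) x].  These
    names suffice: theta distributes over products and inverses, sends a
    constant to another constant and each of the named elements to the next
    one, except the last, which it sends to [theta^(n-1) x = b x b^-1]; and
    that is again a group term in the names.  So theta acts on group terms in
    the names ([shift]), and by recursion every theta-term has a translation
    ([translate]) whose value at the iterates [theta^k (x_i)] is the value of
    the original term at [x].

    Group terms are conversely theta-terms already.  Both implications then
    follow from [translation_noetherian]: the equational noetherian property
    passes from one language to another along any translation of terms that
    preserves values. *)

Set Implicit Arguments.
Unset Strict Implicit.
Unset Printing Implicit Defensive.

Local Open Scope classical_set_scope.
Local Open Scope group_scope.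

(** The solutions of a system are the points whose image under [e] solves the
    translated system, so a finite part of the translated system that has the
    same solutions lifts to such a part of the original one.  The number of
    variables is allowed to change so that [e g] can list, besides [g], further
    elements computed from it. *)
Lemma translation_noetherian (G : groupType) (U V : Type)
    (iU : U -> G -> G) (iV : V -> G -> G) :
  (forall m, exists m' (e : m.-tuple G -> m'.-tuple G)
                    (tr : term G U m -> term G V m'),
     forall g t, eval iV (e g) (tr t) = eval iU g t) ->
  equational_noetherian iV -> equational_noetherian iU.
Proof.
move=> transl noethV m S; have [m' [e [tr trE]]] := transl m.
pose trq (pq : equation G U m) : equation G V m' := (tr pq.1, tr pq.2).
have [S0' [S0'S finS0' solE]] := noethV m' (trq @` S).
have preimage y : exists x : equation G U m, S0' y -> S x /\ trq x = y.
  have [/S0'S [x Sx xy]|nS0'y] := pselect (S0' y); first by exists x.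
  (* a default value: [preimage] must hold of every [y] to apply choice *)
  by exists (Const _ _ 1, Const _ _ 1).
have [lift liftP] := choice preimage.
have S0S : lift @` S0' `<=` S by move=> _ [y /liftP [] Sy _ <-].
exists (lift @` S0'); split=> //; first exact: finite_image.
apply/seteqP; split=> g gsol p q; first by move=> /S0S /gsol.
move=> Spq; suff egsol : solutions iV (trq @` S) (e g).
  by rewrite -!trE; apply: egsol; exists (p, q).
rewrite solE => p' q' S0'pq; have [_] := liftP _ S0'pq.
case liftpq: (lift _) => [r s] [<- <-].
by rewrite !trE; apply: gsol; exists (p', q').
Qed.

Fixpoint relabel (G U V : Type) (f : U -> V) m (t : term G U m) :
    term G V m :=
  match t with
  | Var i => Var _ _ i
  | Const c => Const _ _ c
  | Mul p q => Mul (relabel f p) (relabel f q)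
  | Inv p => Inv (relabel f p)
  | App u p => App (f u) (relabel f p)
  end.

Lemma eval_relabel (G : groupType) (U V : Type) (f : U -> V)
    (iV : V -> G -> G) m (g : m.-tuple G) (t : term G U m) :
  eval iV g (relabel f t) = eval (iV \o f) g t.
Proof. by elim: t => //= [p -> q ->|p ->|u p ->]. Qed.

Lemma multiplicativeV (G H : groupType) (f : {multiplicative G -> H}) :
  {morph f : x / x^-1}.
Proof.
have f1 : f 1 = 1 by apply: (mulgI (f 1)); rewrite -gmulfM !mulg1.
by move=> x; apply: (mulgI (f x)); rewrite -gmulfM !mulgV.
Qed.

Section Elimination.
Variables (G : groupType) (theta : {multiplicative G -> G}) (b : G) (d : nat).
Hypothesis theta_iter : forall x, iter d.+1 theta x = b * x * b^-1.
Variable m : nat.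

(** The pair [(i, k)] names the element [theta^k (x_i)]. *)
Definition nvars : nat := #|{: 'I_m * 'I_d.+1}|.

Definition name (i : 'I_m) (k : 'I_d.+1) : term G void nvars :=
  Var _ _ (enum_rank (i, k)).

Definition iterates (g : m.-tuple G) : nvars.-tuple G :=
  [tuple iter (enum_val v).2 theta (tnth g (enum_val v).1) | v < nvars].

Fixpoint shift (t : term G void nvars) : term G void nvars :=
  match t with
  | Var v =>
      let: (i, k) := enum_val v in
      if insub k.+1 is Some k' then name i k'
      else Mul (Mul (Const _ _ b) (name i ord0)) (Inv (Const _ _ b))
  | Const c => Const _ _ (theta c)
  | Mul p q => Mul (shift p) (shift q)
  | Inv p => Inv (shift p)
  | App u _ => match u with end
  end.

Fixpoint translate (t : term G unit m) : term G void nvars :=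
  match t with
  | Var i => name i ord0
  | Const c => Const _ _ c
  | Mul p q => Mul (translate p) (translate q)
  | Inv p => Inv (translate p)
  | App _ p => shift (translate p)
  end.

Let ev g := eval (of_void (G -> G)) (iterates g).

Lemma eval_name g i k : ev g (name i k) = iter k theta (tnth g i).
Proof. by rewrite /ev /= tnth_mktuple enum_rankK. Qed.

(** Applying [theta] to the last named iterate [theta^d (x_i)] gives
    [theta^(d+1) (x_i)], which has no name of its own; the hypothesis on the
    iterates rewrites it as [b x_i b^-1]. *)
Lemma eval_shift g t : ev g (shift t) = theta (ev g t).
Proof.
elim: t => [v|c|p IHp q IHq|p IHp|[]] //=.
- rewrite [in RHS]/ev /= tnth_mktuple; case: (enum_val v) => i k /=.
  case: insubP => [k' _ k'E|kd]; first by rewrite eval_name k'E.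
  have /eqP kE : k == d :> nat.
    by move: kd; rewrite ltnS -ltnNge eqn_leq -[(k <= d)%N]ltnS ltn_ord ltnS.
  by rewrite kE -iterS theta_iter -[tnth g i in RHS](eval_name g i ord0).
- by rewrite /ev /= -/(ev g) IHp IHq gmulfM.
- by rewrite /ev /= -/(ev g) IHp multiplicativeV.
Qed.

Lemma eval_translate g t :
  ev g (translate t) = eval (fun _ : unit => theta : G -> G) g t.
Proof.
elim: t => [i|c|p IHp q IHq|p IHp|u p IHp] //=.
- by rewrite eval_name.
- by rewrite -IHp -IHq.
- by rewrite -IHp.
- by rewrite eval_shift IHp.
Qed.

End Elimination.

Theorem corollary6p2 (G : groupType) (theta : {multiplicative G -> G})
    (theta_bij : bijective theta) (b : G) (n : nat) (n_gt2 : (2 < n)%N)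
    (theta_b : theta b = b)
    (theta_iter : forall x : G, iter n.-1 theta x = (b * x * b^-1)%g) :
  equational_noetherian_L G <-> equational_noetherian_Ltheta theta.
Proof.
split; apply: translation_noetherian => m.
- case: n n_gt2 theta_iter => [|[|d]] // _ theta_iter.
  exists (nvars d m), (@iterates _ theta d m), (@translate _ theta b d m).
  exact: (eval_translate theta_iter).
- exists m, id, (@relabel _ _ _ (of_void unit) m) => g t.
  by rewrite eval_relabel; congr (eval _ g t); apply/funext; case.
Qed.
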